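(* There exists a universal constant $c>0$ such that for all $L,R>0$, all $\delta\in(0,\tfrac12)$ and all $T\in\mathbb{N}$, $$\mathsf{Err}_T^{\delta}\big(\mathcal{A}_{\mathsf{SO}},\mathcal{I}_{\mathsf{Lip}}^{L,R}\big)\;\ge\; c\,LR\,\min\left\{\sqrt{\frac{\log\frac1\delta}{T}},\,1\right\}.$$
   Context: Here $\mathbb{N}=\{1,2,\dots\}$, $\log$ is the natural logarithm, and the domain is $\mathcal{X}=\mathbb{R}$. A stochastic optimization (SO) instance is a pair $(f,P)$, where $P$ is a probability distribution on a sample space $\mathcal{S}$ and $f:\mathcal{X}\times\mathcal{S}\to\mathbb{R}$ is such that $F_{f,P}(x):=\mathbb{E}_{S\sim P}f(x;S)$ is well defined and finite for all $x\in\mathcal{X}$. Let $X^\star_{f,P}:=\arg\min_{x\in\mathcal{X}}F_{f,P}(x)$; the norm of a set is the infimum of the norms of its elements ($\infty$ for the empty set). $\mathcal{I}_{\mathsf{Lip}}^{L,R}$ is the class of instances $(f,P)$ such that $f(\cdot;s)$ is convex and $L$-Lipschitz on $\mathcal{X}$ for all $s\in\mathcal{S}$, and $\|X^\star_{f,P}\|\le R$. $\mathcal{A}_{\mathsf{SO}}$ is the set of all SO algorithms: given $S_1,\dots,S_T$ i.i.d. from $P$ and independent $\xi\sim\mathsf{Unif}([0,1])$, the output is $x_T=\mathsf{alg}_T(f(\cdot;S_1),\dots,f(\cdot;S_T);\xi)\in\mathcal{X}$ for some measurable mapping $\mathsf{alg}_T$. The error at confidence level $\delta$ is $\mathsf{Err}_T^{\delta}(\mathsf{alg},(f,P)):=Q_{1-\delta}(F_{f,P}(x_T))-\inf_{x\in\mathcal{X}}F_{f,P}(x)$,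 where $Q_p(Y):=\min\{y:\mathbb{P}(Y\le y)\ge p\}$, and the minimax error of a class $\mathcal{I}$ is $\mathsf{Err}_T^{\delta}(\mathcal{A}_{\mathsf{SO}},\mathcal{I}):=\inf_{\mathsf{alg}\in\mathcal{A}_{\mathsf{SO}}}\sup_{(f,P)\in\mathcal{I}}\mathsf{Err}_T^{\delta}(\mathsf{alg},(f,P))$. *)

(* Defs.v *)
From HB Require Import structures.
From mathcomp Require Import all_boot all_order all_algebra.
From mathcomp Require Import all_classical all_reals all_analysis.
From mathcomp Require Import measurable_realfun.

Set Implicit Arguments.
Unset Strict Implicit.
Unset Printing Implicit Defensive.

Import Order.TTheory GRing.Theory Num.Theory.
Import numFieldNormedType.Exports.

Local Open Scope classical_set_scope.
Local Open Scope ring_scope.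

Section iid_law.
Context d (S : measurableType d) (R : realType) (P : probability S R).

Definition tuple_cons n (x : S * n.-tuple S) : n.+1.-tuple S :=
  [tuple of x.1 :: x.2].

Let measurable_tuple_cons n : measurable_fun setT (@tuple_cons n).
Proof. exact: measurable_cons. Qed.

HB.instance Definition _ n :=
  isMeasurableFun.Build _ _ _ _ (@tuple_cons n) (@measurable_tuple_cons n).

(* The joint law of n i.i.d. draws from P, i.e. the n-fold product measure:
   see [iid_lawE] below. *)
Fixpoint iid_law (n : nat) : probability (n.-tuple S) R :=
  match n with
  | 0 => \d_([tuple] : 0.-tuple S)
  | m.+1 => distribution (P \x iid_law m)%E (@tuple_cons m)
  end.

Lemma iid_lawE n (A : 'I_n -> set S) : (forall i, measurable (A i)) ->
  iid_law n [set t | forall i, A i (tnth t i)] = (\prod_(i < n) P (A i))%E.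
Proof.
elim: n A => [|n IHn] A mA.
  by rewrite big_ord0 /= diracE mem_set// => -[].
rewrite big_ord_recl -IHn; last by move=> i; exact: mA.
rewrite /= /distribution /pushforward.
set B := [set t | forall i : 'I_n, A (lift ord0 i) (tnth t i)].
have mB : measurable B.
  have -> : B = \bigcap_(i in [set: 'I_n])
      (fun t : n.-tuple S => tnth t i) @^-1` A (lift ord0 i).
    by apply/seteqP; split=> t /= Bt i => [_|]; exact: Bt.
  apply: fin_bigcap_measurable => // i _.
  by rewrite -[X in measurable X]setTI; exact: measurable_tnth.
rewrite -product_measure1E//; congr (_ _).
apply/seteqP; split=> -[x t] /=.
  move=> H; split; first exact: (H ord0).
  by move=> i /=; have := H (lift ord0 i); rewrite tnthS.
move=> [/= Ax Bt] i; case: (unliftP ord0 i) => [j|] ->//.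
by rewrite tnthS; exact: Bt.
Qed.

End iid_law.

(* The largest lower bound, in [\bar R], of the y with Pr (Y <= y) >= p.  It is
   a minimum for 0 < p < 1: see [quantileP]. *)
Definition quantile d (W : measurableType d) (R : realType)
    (Pr : probability W R) (p : R) (Y : W -> R) : \bar R :=
  ereal_inf [set y%:E | y in [set y | p%:E <= Pr [set w | (Y w <= y)%R]]%E].

Lemma quantileP d (W : measurableType d) (R : realType)
    (Pr : probability W R) (p : R) (Y : W -> R) :
  measurable_fun setT Y -> 0 < p < 1 ->
  exists y, [/\ quantile Pr p Y = y%:E,
    (p%:E <= Pr [set w | (Y w <= y)%R])%E &
    forall z, (p%:E <= Pr [set w | (Y w <= z)%R])%E -> y <= z].
Proof.
move=> mY /andP[p0 p1].
pose X : {RV Pr >-> R} := HB.pack_for {mfun W >-> R} Y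
  (isMeasurableFun.Build _ _ _ _ Y mY).
have cdfE z : Pr [set w | (Y w <= z)%R] = cdf X z.
  by congr (Pr _); apply/seteqP; split=> w /=; rewrite in_itv.
rewrite /quantile; under eq_set do rewrite cdfE.
set A := [set z | (p%:E <= cdf X z)%E].
have upA z z' : z <= z' -> A z -> A z'.
  by move=> zz' /le_trans; apply; exact: cdf_nondecreasing.
have A0 : A !=set0.
  apply/set0P/eqP => A0.
  have : (1 <= p%:E)%E.
    apply: cvge_le (cvg_cdfy1 X); apply: nearW => z.
    have /negP : ~ A z by rewrite A0.
    by rewrite /A /= -ltNge => /ltW.
  by rewrite lee_fin leNgt p1.
have lbA : has_lbound A.
  apply: contrapT => nlb.
  have : (p%:E <= 0)%E.
    apply: cvge_ge (cvg_cdfNy0 X); apply: nearW => m.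
    apply: contrapT => nAm; apply: nlb; exists m => z Az.
    by rewrite leNgt; apply/negP => /ltW/upA /(_ Az).
  by rewrite lee_fin leNgt p0.
exists (inf A); split.
- by rewrite -ereal_inf_EFin.
- rewrite cdfE; apply: cvge_ge (@cdf_right_continuous _ _ _ _ X (inf A)).
  near=> z.
  have zA : inf A < z by near: z; exact: nbhs_right_gt.
  have [] := @inf_adherent R A (z - inf A); rewrite ?subr_gt0//.
  move=> z' Az'; rewrite addrC subrK => /ltW z'z; exact: upA z'z Az'.
- by move=> z; rewrite cdfE => Az; exact: ge_inf.
Unshelve. all: by end_near.
Qed.

(* An instance carries its own sample space.  Integrability of each [loss x]
   says that the expected loss is well defined and finite. *)
Record so_instance (R : realType) := SOInstance {
  so_display : measure_display ;
  sample_space : measurableType so_display ;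
  sample_prob : probability sample_space R ;
  loss : R -> sample_space -> R ;
  loss_integrable :
    forall x, sample_prob.-integrable setT (EFin \o loss x) }.

Section instances.
Context (R : realType).
Implicit Type I : so_instance R.

Definition risk I (x : R) : R := fine 'E_(sample_prob I)[@loss R I x].

Definition minimizers I : set R := [set x | forall y, risk I x <= risk I y].

(* [ereal_inf set0] is [+oo]. *)
Definition set_norm (A : set R) : \bar R := ereal_inf [set `|x|%:E | x in A].

Definition lip_class (L rho : R) I : Prop :=
  [/\ forall s, convex_function [set: R] (fun x => @loss R I x s),
      forall s, L.-lipschitz (fun x : R^o => @loss R I x s : R^o) &
      (set_norm (minimizers I) <= rho%:E)%E].

End instances.

(* Functions R -> R with the sigma-algebra generated by the evaluation maps. On
   continuous functions, hence on all convex real-valued ones, it is the trace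
   of the Borel sigma-algebra of locally uniform convergence. *)
Definition cylinders (R : realType) : set (set (R -> R)) :=
  [set A | exists (x : R) (B : set R),
     measurable B /\ A = (fun h => h x) @^-1` B].

Definition fun_space (R : realType) := g_sigma_algebraType (@cylinders R).

(* The last argument is the random seed. *)
Definition so_algorithm (R : realType) :=
  forall T : nat, {mfun (T.-tuple (fun_space R) * measurableTypeR R)%type >-> R}.

Section errors.
Context (R : realType).
Implicit Types (I : so_instance R) (alg : so_algorithm R).

Definition sampled I (T : nat)
    (w : T.-tuple (sample_space I) * measurableTypeR R) :
    T.-tuple (fun_space R) * measurableTypeR R :=
  ([tuple of [seq (fun x => @loss R I x s) | s <- w.1]], w.2).

Lemma measurable_sampled I T : measurable_fun setT (@sampled I T).
Proof.
pose g (s : sample_space I) : fun_space R := fun x => loss x s.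
have mg : measurable_fun setT g.
  apply: (@measurability _ _ _ (fun_space R) _ _ (@cylinders R)) => //.
  move=> _ [_ [x [B [mB ->]]] <-].
  have /measurable_int/measurable_EFinP mx := @loss_integrable R I x.
  exact: mx.
apply: measurable_fun_pair => //; apply/measurable_fun_tnthP => i.
rewrite (_ : _ \o _ = g \o (fun w => tnth w.1 i)); last first.
  by apply/funext => w /=; rewrite tnth_map.
apply: (measurableT_comp mg).
exact: (measurableT_comp (measurable_tnth i) measurable_fst).
Qed.

Definition sample_law I (T : nat) :
    probability (T.-tuple (sample_space I) * measurableTypeR R)%type R :=
  (iid_law (sample_prob I) T \x uniform_prob (@ltr01 R))%E.

Definition err alg (T : nat) (delta : R) I : \bar R :=
  (quantile (sample_law I T) (1 - delta)
      (fun w => risk I (alg T (sampled w)))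
    - ereal_inf [set (risk I x)%:E | x in [set: R]])%E.

(* [set] is too small a universe for sets of instances, which contain types:
   a class of instances is a plain predicate. *)
Definition sup_err alg (T : nat) (delta : R) (C : so_instance R -> Prop) :
    \bar R :=
  ereal_sup [set e | exists2 I, C I & err alg T delta I = e].

Definition minimax_err (T : nat) (delta : R) (C : so_instance R -> Prop) :
    \bar R :=
  ereal_inf [set sup_err alg T delta C | alg in [set: so_algorithm R]].

End errors.

(* Main.v *)
Require Import Defs.
From mathcomp Require Import all_boot all_order all_algebra.
From mathcomp Require Import all_classical all_reals all_analysis.
From mathcomp Require Import measurable_realfun ring lra.

Set Implicit Arguments.
Unset Strict Implicit.
Unset Printing Implicit Defensive.

Import Order.TTheory GRing.Theory Num.Theory.

Local Open Scope classical_set_scope.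
Local Open Scope ring_scope.

(** Three instances share one loss on a coin-valued sample: a convex well plus a
    linear term whose sign is the coin.  A coin of bias 0, [eta] or [- eta]
    gives a risk minimized at 0, [rho] or [- rho], and the sets of outputs whose
    excess risk is below [L * rho * eta / 8] are pairwise disjoint.  If an
    algorithm succeeded with probability [1 - delta] on all three, then under
    the fair coin one of the two side sets would have probability at most
    [delta / 2], while it has probability at least [1 - delta] under its own
    coin; for [eta] of order [sqrt (ln (1 / delta) / T)] the chi-square distance
    [(1 + eta ^+ 2) ^+ T - 1] of the samples is too small for that.  With two
    instances only, the argument would break down as [delta] tends to 1/2. *)

(** * Finite sums over tuples and the chi-square change of measure *)

Lemma sum_tuple_prod (R : comNzRingType) (A : finType) n (g : A -> R) :
  \sum_(w : n.-tuple A) \prod_(i < n) g (tnth w i) = (\sum_a g a) ^+ n.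
Proof.
rewrite -[n in RHS]card_ord -prodr_const bigA_distr_bigA/=.
rewrite (reindex (@tuple_of_finfun A n))/=; last first.
  exists (@finfun_of_tuple A n) => x _; first exact: tuple_of_finfunK.
  exact: finfun_of_tupleK.
by apply: eq_bigr => f _; apply: eq_bigr => i _; rewrite tnth_mktuple.
Qed.

(* Cauchy-Schwarz for the density ratio [p / p0 - 1], in the additive form
   [u * f <= t * u ^+ 2 + f / (4 * t)], valid because [f ^+ 2 <= f]. *)
Lemma chi2_change_of_measure (R : realFieldType) (A : finType)
    (p0 p phi : A -> R) (t : R) :
  (forall a, 0 < p0 a) -> \sum_a p0 a = 1 -> \sum_a p a = 1 ->
  (forall a, 0 <= phi a <= 1) -> 0 < t ->
  \sum_a p a * phi a <= \sum_a p0 a * phi a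
    + t * (\sum_a p a ^+ 2 / p0 a - 1) + (\sum_a p0 a * phi a) / (4 * t).
Proof.
move=> p00 sp0 sp phi01 t0.
(* As [p] and [p0] both sum to 1, the chi-square distance is the [p0]-mean of the squared density
   deviation, so the claim can be checked term by term. *)
have -> : \sum_a p a ^+ 2 / p0 a - 1 =
    \sum_a (p a ^+ 2 / p0 a - 2 * p a + p0 a).
  by rewrite big_split/= sumrB -mulr_sumr sp sp0; ring.
rewrite mulr_sumr mulr_suml -!big_split/=; apply: ler_sum => a _.
have /andP[f0 f1] := phi01 a; have a0 := p00 a.
set u := p a / p0 a - 1.
have -> : p a = p0 a * (1 + u) by rewrite /u; field; lra.
set f := phi a in f0 f1 *.
have -> : p0 a * f
    + t * ((p0 a * (1 + u)) ^+ 2 / p0 a - 2 * (p0 a * (1 + u)) + p0 a)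
    + p0 a * f / (4 * t) = p0 a * (f + t * u ^+ 2 + f / (4 * t)) by field; lra.
rewrite -mulrA ler_pM2l//.
have -> : f + t * u ^+ 2 + f / (4 * t) =
    (1 + u) * f + (t * (u - f / (2 * t)) ^+ 2 + f * (1 - f) / (4 * t)).
  by field; lra.
rewrite lerDl addr_ge0//; first by rewrite mulr_ge0 ?sqr_ge0// ltW.
by rewrite divr_ge0 ?mulr_ge0// ?subr_ge0// ltW.
Qed.

(** * Laws and expectations for coin-valued samples *)

(** There are finitely many tuples of coins, so [X] is a finite disjoint union of rectangles, one
    over each tuple. *)
Lemma iid_law_seedE d (V : measurableType d) (R : realType)
    (P : probability bool R) (U : probability V R) (T : nat)
    (X : set (T.-tuple bool * V)) : measurable X ->
  ((iid_law P T \x U) X =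
    \sum_(w : T.-tuple bool)
      (\prod_(i < T) P [set tnth w i]) * U (xsection X w))%E.
Proof.
move=> mX.
have mw (w : T.-tuple bool) : measurable [set w].
  have -> : [set w] = \bigcap_(i in [set: 'I_T])
      (fun t : T.-tuple bool => tnth t i) @^-1` [set tnth w i].
    apply/seteqP; split=> t /= => [->//|H].
    by apply: eq_from_tnth => i; exact: H.
  apply: fin_bigcap_measurable => // i _.
  by rewrite -[X in measurable X]setTI; exact: measurable_tnth.
have {1}-> : X = \bigcup_(w in [set: T.-tuple bool]) ([set w] `*` xsection X w).
  apply/seteqP; split=> [[w u] Xwu|[w u] [w' _ [/= ->]]].
    by exists w => //; split=> //=; apply/xsectionP.
  by move/xsectionP.
rewrite measure_fin_bigcup//=; last 2 first.
- by move=> w w' _ _ [[x u] [[/= -> _] [/= -> _]]].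
- by move=> w _; apply: measurableX => //; exact: measurable_xsection.
have -> : [set: T.-tuple bool] = [set` index_enum (T.-tuple bool)].
  by apply/seteqP; split=> // w _ /=; exact: mem_index_enum.
rewrite -fsbig_seq ?index_enum_uniq//; apply: eq_bigr => w _.
rewrite product_measure1E//; last exact: measurable_xsection.
congr (_ * _)%E.
rewrite -(@iid_lawE _ _ _ P T (fun i => [set tnth w i]))//.
congr (iid_law _ _ _); apply/seteqP; split=> t /= => [->//|H].
by apply: eq_from_tnth => i; exact: H.
Qed.

Lemma expectation_bernoulli (R : realType) (p : R) (f : bool -> R) :
  0 <= p <= 1 ->
  'E_(bernoulli_prob p)[f]%E = (p * f true + (1 - p) * f false)%:E.
Proof.
move=> p01; rewrite unlock integralE.
rewrite !integral_bernoulli_prob// !(funeposE, funenegE)/=.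
rewrite -!EFin_max -!EFinM -!EFinD.
(* The positive part is [x] plus the negative part; this recombines the two integrals into which
   [integralE] splits the expectation. *)
have maxNE (x : R) : Num.max x 0 = x + Num.max (- x) 0.
  by rewrite /Num.max; case: (ltP x 0) => ?; case: (ltP (- x) 0) => ?; lra.
by congr EFin; rewrite (maxNE (f true)) (maxNE (f false)) /unstable.onem; ring.
Qed.

(** * From a small quantile error to a likely small excess risk *)

Section small_error.
Context (R : realType) (alg : so_algorithm R) (T : nat) (I : so_instance R).

Definition excess_risk (r : R)
    (w : T.-tuple (sample_space I) * measurableTypeR R) :=
  risk I (alg T (sampled w)) - r.

Lemma measurable_excess_risk (r : R) (i : interval R) :
  measurable_fun [set: R] (risk I) ->
  measurable [set w | excess_risk r w \in i].
Proof.
move=> mrisk.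
have mr : measurable_fun setT (excess_risk r).
  apply: measurable_funB => //; apply: (measurableT_comp mrisk).
  apply: (measurableT_comp (measurable_funP (alg T))).
  exact: measurable_sampled.
by rewrite -[X in measurable X]setTI; exact: (mr _ [set` i]).
Qed.

(** The quantile is an infimum of levels, so if it lies strictly below [risk I x0 + e], then some
    level [y] below that bound already carries mass [1 - delta]. *)
Lemma small_err_prob (delta e x0 : R) :
  measurable_fun [set: R] (risk I) ->
  minimizers I x0 -> (err alg T delta I < e%:E)%E ->
  ((1 - delta)%:E <=
    sample_law I T [set w | (excess_risk (risk I x0) w < e)%R])%E.
Proof.
move=> mrisk minx0; rewrite /err.
have -> : ereal_inf [set (risk I x)%:E | x in [set: R]] = (risk I x0)%:E.
  apply/eqP; rewrite eq_le; apply/andP; split.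
    by apply: ereal_inf_lbound; exists x0.
  by apply: le_ereal_inf_tmp => _ [x _ <-]; rewrite lee_fin.
rewrite lteBlDr// -EFinD => /ereal_inf_lt[_ [y /= Py <-]].
rewrite lte_fin => ye; apply: (le_trans Py).
have mexc r i := measurable_excess_risk r i mrisk.
apply: le_measure; rewrite ?inE.
- have := mexc 0 `]-oo, y]; rewrite /excess_risk.
  by under eq_set do rewrite in_itv/= subr0.
- have := mexc (risk I x0) `]-oo, e[.
  by under eq_set do rewrite in_itv/=.
- move=> w /= /le_lt_trans; rewrite /excess_risk ltrBlDl; apply.
  by rewrite addrC.
Qed.

End small_error.

(** * The tilted wells: class membership, minimizers and gaps *)

Section hard_instance.
Context (R : realType) (L rho eta : R).

(** The slope [eta / 4] near 0 is beaten by a tilt of slope [eta / 2], which drives the minimizer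
    away from 0; the extra slope [1 / 4] beyond [rho] stops it there when [eta <= 1]. *)
Definition well (x : R) : R :=
  eta * `|x| / 4 + Num.max (`|x| - rho) 0 / 4.

Definition tilted_loss (x : R) (b : bool) : R :=
  L * (well x - (if b then x else - x) / 2).

Lemma tilted_loss_integrable (p x : R) :
  (bernoulli_prob p).-integrable setT (EFin \o tilted_loss x).
Proof.
apply: measurable_bounded_integrable => //.
  by apply: le_lt_trans (ltry 1); exact: (probability_le1 (bernoulli_prob p)).
exists (`|tilted_loss x true| + `|tilted_loss x false|); split=> // M.
by move=> /ltW leM [] _ /=; apply: le_trans leM; rewrite ?lerDl ?lerDr.
Qed.

(** With this bias, [theta] is the mean of the sign encoded by the coin, hence the coefficient of
    the tilt in the risk. *)
Definition tilted_instance (theta : R) : so_instance R :=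
  SOInstance (tilted_loss_integrable ((1 + theta) / 2)).

Lemma tilted_riskE theta x : -1 <= theta <= 1 ->
  risk (tilted_instance theta) x = L * (well x - theta * x / 2).
Proof.
move=> th; rewrite /risk expectation_bernoulli/=; last lra.
by rewrite /tilted_loss/=; field.
Qed.

Lemma well_ge0 x : 0 <= eta -> 0 <= well x.
Proof.
by move=> e0; rewrite addr_ge0// !mulr_ge0// le_max lexx orbT.
Qed.

Lemma well_ge_norm x : eta * `|x| / 4 <= well x.
Proof. by rewrite lerDl mulr_ge0// ?le_max ?lexx ?orbT. Qed.

Lemma well_conv (s t x y : R) : 0 <= eta -> 0 <= s -> 0 <= t -> s + t = 1 ->
  well (s * x + t * y) <= s * well x + t * well y.
Proof.
move=> e0 s0 t0 st.
have nz : `|s * x + t * y| <= s * `|x| + t * `|y|.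
  by rewrite (le_trans (ler_normD _ _))// !normrM (ger0_norm s0) (ger0_norm t0).
have mz : Num.max (`|s * x + t * y| - rho) 0 <=
    s * Num.max (`|x| - rho) 0 + t * Num.max (`|y| - rho) 0.
  have mge (u : R) : u <= Num.max u 0 /\ 0 <= Num.max u 0.
    by split; rewrite le_max lexx ?orbT.
  have [x1 x2] := mge (`|x| - rho); have [y1 y2] := mge (`|y| - rho).
  rewrite ge_max addr_ge0 ?mulr_ge0// andbT.
  have := ler_wpM2l s0 x1; have := ler_wpM2l t0 y1.
  have : (s + t) * rho = rho by rewrite st mul1r.
  lra.
have := ler_wpM2l e0 nz; rewrite /well; lra.
Qed.

(** The slopes [eta / 4] and [1 / 4] add up to at most [1 / 2]; the linear term of the loss takes
    the other half of the Lipschitz budget. *)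
Lemma well_sub_le x y : 0 <= eta <= 1 -> well x - well y <= `|x - y| / 2.
Proof.
move=> /andP[e0 e1].
have nxy : `|x| - `|y| <= `|x - y| := lerB_dist x y.
have mxy : Num.max (`|x| - rho) 0 - Num.max (`|y| - rho) 0 <= `|x - y|.
  have := normr_ge0 (x - y).
  rewrite /Num.max; case: (ltP (`|x| - rho)) => ?;
    case: (ltP (`|y| - rho)) => ?; lra.
have := normr_ge0 (x - y); set d := `|x - y| in nxy mxy *.
have := ler_wpM2l e0 nxy => h1 d0.
have : (1 - eta) * d >= 0 by rewrite mulr_ge0//; lra.
rewrite /well; lra.
Qed.

Lemma tilted_loss_conv (s x y : R) b : 0 <= L -> 0 <= eta ->
    0 <= s -> 0 <= 1 - s ->
  tilted_loss (s * x + (1 - s) * y) b <=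
    s * tilted_loss x b + (1 - s) * tilted_loss y b.
Proof.
move=> L0 e0 s0 s1.
have := ler_wpM2l L0 (well_conv x y e0 s0 s1 (subrKC _ _)).
by rewrite /tilted_loss; case: b => /=; lra.
Qed.

Lemma tilted_convex b : 0 <= L -> 0 <= eta ->
  convex_function [set: R] (fun x => tilted_loss x b).
Proof.
move=> L0 e0 t x y _ _; rewrite !convRE /unstable.onem.
by apply: tilted_loss_conv; rewrite ?subr_ge0.
Qed.

Lemma tilted_loss_lip (x y : R) b : 0 <= L -> 0 <= eta <= 1 ->
  `|tilted_loss x b - tilted_loss y b| <= L * `|x - y|.
Proof.
move=> L0 e01; rewrite /tilted_loss -mulrBr normrM (ger0_norm L0) ler_wpM2l//.
have := ler_norm (x - y); have := ler_norm (y - x).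
have := well_sub_le x y e01; have := well_sub_le y x e01; rewrite (distrC y x).
by rewrite ler_norml; case: b => /=; lra.
Qed.

Lemma tilted_lip b : 0 <= L -> 0 <= eta <= 1 ->
  L.-lipschitz (fun x : R^o => tilted_loss x b : R^o).
Proof. by move=> L0 e01 [x y] _; exact: tilted_loss_lip. Qed.

(** The bound is the value at [rho]. Up to [rho] the first term of the well gives at least
    [- eta * x / 4]; beyond [rho] the second one adds a surplus of [(1 - eta) * (x - rho) / 4]. *)
Lemma well_tilt_ge x : 0 <= eta <= 1 ->
  - (eta * rho / 4) <= well x - eta * x / 2.
Proof.
move=> /andP[e0 e1]; have := ler_wpM2l e0 (ler_norm x) => ex.
have [xr|rx] := leP x rho.
  by have := ler_wpM2l e0 xr; have := well_ge_norm x; lra.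
have m : `|x| - rho <= Num.max (`|x| - rho) 0 by rewrite le_max lexx.
have : 0 <= (1 - eta) * (x - rho) by rewrite mulr_ge0//; lra.
by have := ler_norm x; rewrite /well; lra.
Qed.

(** Halfway to [rho] at most half of the optimal depth [eta * rho / 4] is reached, which leaves a
    gap of [eta * rho / 8]. *)
Lemma well_tilt_gap x : 0 <= eta -> 0 <= rho -> x <= rho / 2 ->
  - (eta * rho / 8) <= well x - eta * x / 2.
Proof.
move=> e0 r0 xr.
have := ler_wpM2l e0 xr; have := ler_wpM2l e0 (ler_norm x).
have := well_ge_norm x; lra.
Qed.

Lemma well0 : 0 <= rho -> well 0 = 0.
Proof.
by move=> r0; rewrite /well normr0 sub0r max_r ?oppr_le0// mulr0 !mul0r addr0.
Qed.

Lemma well_rho : 0 <= rho -> well rho = eta * rho / 4.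
Proof. by move=> r0; rewrite /well ger0_norm// subrr maxxx mul0r addr0. Qed.

(** By this symmetry both side instances are handled at once, with [s = false] for the minimizer
    [rho] and [s = true] for [- rho]. *)
Lemma well_sign (s : bool) x : well ((-1) ^+ s * x) = well x.
Proof. by rewrite /well normrMsign. Qed.

Let sgn_theta (s : bool) : 0 <= eta <= 1 -> -1 <= (-1) ^+ s * eta <= 1.
Proof. by move=> /andP[e0 e1]; case: s; rewrite ?expr1 ?expr0; lra. Qed.

Lemma minimizers_tilted0 : 0 <= L -> 0 <= rho -> 0 <= eta ->
  minimizers (tilted_instance 0) 0.
Proof.
move=> L0 r0 e0 y; rewrite !tilted_riskE; [|lra..].
rewrite !mul0r !subr0 ler_wpM2l//.
by rewrite well0 ?well_ge0.
Qed.

Lemma minimizers_tilted (s : bool) : 0 <= L -> 0 <= rho -> 0 <= eta <= 1 ->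
  minimizers (tilted_instance ((-1) ^+ s * eta)) ((-1) ^+ s * rho).
Proof.
move=> L0 r0 e01 y; rewrite !tilted_riskE; [|exact: sgn_theta..].
rewrite ler_wpM2l// well_sign well_rho// -(well_sign s y).
have := well_tilt_ge ((-1) ^+ s * y) e01.
by case: s; rewrite ?expr1 ?expr0; lra.
Qed.

Lemma tilted0_gap x : 0 <= L -> 0 <= rho -> 0 <= eta -> rho / 2 <= `|x| ->
  L * rho * eta / 8 <= risk (tilted_instance 0) x - risk (tilted_instance 0) 0.
Proof.
move=> L0 r0 e0 hx; rewrite !tilted_riskE; [|lra..].
have := ler_wpM2l L0 (ler_wpM2l e0 hx); have := ler_wpM2l L0 (well_ge_norm x).
by rewrite well0//; lra.
Qed.

Lemma tilted_gap (s : bool) x : 0 <= L -> 0 <= rho -> 0 <= eta <= 1 ->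
  (-1) ^+ s * x <= rho / 2 ->
  L * rho * eta / 8 <= risk (tilted_instance ((-1) ^+ s * eta)) x
    - risk (tilted_instance ((-1) ^+ s * eta)) ((-1) ^+ s * rho).
Proof.
move=> L0 r0 e01 hx; have /andP[e0 _] := e01.
rewrite !tilted_riskE; [|exact: sgn_theta..].
rewrite well_sign well_rho// -(well_sign s x).
have := ler_wpM2l L0 (well_tilt_gap e0 r0 hx).
by case: s hx; rewrite ?expr1 ?expr0; lra.
Qed.

Lemma measurable_tilted_risk theta : -1 <= theta <= 1 ->
  measurable_fun [set: R] (risk (tilted_instance theta)).
Proof.
move=> th; have -> : risk (tilted_instance theta) =
    fun x => L * (well x - theta * x / 2).
  by apply/funext => x; exact: tilted_riskE.
have mn : measurable_fun setT (fun x : R => `|x|) by exact: normr_measurable.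
apply: measurable_funM => //; apply: measurable_funB.
  apply: measurable_funD; apply: measurable_funM => //.
    exact: measurable_funM.
  by apply: measurable_maxr => //; exact: measurable_funB.
by apply: measurable_funM => //; exact: measurable_funM.
Qed.

Lemma tilted_lip_class theta x0 : 0 <= L -> 0 <= eta <= 1 ->
  minimizers (tilted_instance theta) x0 -> `|x0| <= rho ->
  lip_class L rho (tilted_instance theta).
Proof.
move=> L0 e01 minx0 x0r; have /andP[e0 _] := e01; split.
- by move=> b; exact: tilted_convex.
- by move=> b; exact: tilted_lip.
- apply: ereal_inf_le; exists (`|x0|%:E); last by rewrite lee_fin.
  by exists x0.
Qed.

End hard_instance.

(** * Mass functions of coin samples and their chi-square distance *)

Definition bern_pmf (R : realType) (theta : R) (b : bool) : R :=
  (if b then 1 + theta else 1 - theta) / 2.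

Definition bern_tuple_pmf (R : realType) (theta : R) T (w : T.-tuple bool) :
  R :=
  \prod_(i < T) bern_pmf theta (tnth w i).

Lemma sum_bern_tuple_pmf (R : realType) (theta : R) T :
  \sum_(w : T.-tuple bool) bern_tuple_pmf theta w = 1.
Proof.
rewrite sum_tuple_prod big_bool /bern_pmf/= -[RHS](expr1n _ T).
by congr (_ ^+ _); field.
Qed.

(** The summand factors over the coordinates, and one coin contributes [((1 + theta) ^+ 2 + (1 -
    theta) ^+ 2) / 2]. *)
Lemma chi2_bern_tuple_pmf (R : realType) (theta : R) T :
  \sum_(w : T.-tuple bool) bern_tuple_pmf theta w ^+ 2 / bern_tuple_pmf 0 w =
  (1 + theta ^+ 2) ^+ T.
Proof.
under eq_bigr do rewrite -prodrXl -prodf_div.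
rewrite (sum_tuple_prod _ (fun b => bern_pmf theta b ^+ 2 / bern_pmf 0 b)).
by rewrite big_bool /bern_pmf/=; congr (_ ^+ _); field.
Qed.

(** Integrating out the seed turns an event into a randomized test on a finite space: the factor
    multiplying the mass of [w] is the conditional probability of [D] given the coins. *)
Lemma iid_bernoulliE (R : realType) (theta : R) d (V : measurableType d)
    (U : probability V R) T (D : set (T.-tuple bool * V)) :
  measurable D -> -1 <= theta <= 1 ->
  (iid_law (bernoulli_prob ((1 + theta) / 2)) T \x U)%E D =
  (\sum_(w : T.-tuple bool)
    bern_tuple_pmf theta w * fine (U (xsection D w)))%:E.
Proof.
move=> mD th; rewrite iid_law_seedE// -sumEFin; apply: eq_bigr => w _.
rewrite EFinM fineK ?fin_num_measure//; last exact: measurable_xsection.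
congr (_ * _)%E; rewrite -prodEFin; apply: eq_bigr => i _.
rewrite [LHS]bernoulli_probE; last lra.
rewrite !diracE /bern_pmf /unstable.onem.
case: (tnth w i).
  by rewrite mem_set// memNset//= mule0 adde0 mule1.
by rewrite memNset// mem_set//= mule0 add0e mule1; congr EFin; field.
Qed.

(** * The three-point test and the calibration of [eta] *)

(** Under the fair coin the middle test has mass at least [1 - delta] and each side test more than
    [delta / 2], which exceeds the total of 1. *)
Lemma three_point_test (R : realType) (T : nat) (eta delta : R)
    (phi0 phip phim : T.-tuple bool -> R) :
  0 < delta < 1 / 2 -> delta * (1 + eta ^+ 2) ^+ T <= 3 / 5 ->
  (forall w, 0 <= phi0 w) -> (forall w, 0 <= phip w) ->
  (forall w, 0 <= phim w) -> (forall w, phi0 w + phip w + phim w <= 1) ->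
  1 - delta <= \sum_w bern_tuple_pmf 0 w * phi0 w ->
  1 - delta <= \sum_w bern_tuple_pmf eta w * phip w ->
  1 - delta <= \sum_w bern_tuple_pmf (- eta) w * phim w ->
  False.
Proof.
move=> /andP[d0 d2] dM f0 fp fm f1 h0 hp hm.
have p0 (w : T.-tuple bool) : 0 < bern_tuple_pmf (0 : R) w.
  by apply: prodr_gt0 => i _; rewrite /bern_pmf; case: ifP; lra.
have key (phi : T.-tuple bool -> R) (theta : R) : (forall w, 0 <= phi w <= 1) ->
    theta ^+ 2 = eta ^+ 2 ->
    1 - delta <= \sum_w bern_tuple_pmf theta w * phi w ->
    delta / 2 < \sum_w bern_tuple_pmf 0 w * phi w.
  (* Taking [t = delta], a fair-coin mass of at most [delta / 2] would give [1 - delta <= delta / 2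
     + (3 / 5 - delta) + 1 / 8], that is [delta >= 11 / 20]. *)
  move=> phi01 th2 h; rewrite ltNge; apply/negP => q.
  have := chi2_change_of_measure p0 (sum_bern_tuple_pmf 0 T)
    (sum_bern_tuple_pmf theta T) phi01 d0.
  rewrite chi2_bern_tuple_pmf th2.
  set Q := \sum_w _ in q *.
  have : Q / (4 * delta) <= 1 / 8.
    by rewrite ler_pdivrMr; lra.
  move: dM; set M := _ ^+ T; lra.
have : \sum_w bern_tuple_pmf 0 w * phi0 w + \sum_w bern_tuple_pmf 0 w * phip w
    + \sum_w bern_tuple_pmf 0 w * phim w <= 1.
  rewrite -!big_split/= -(sum_bern_tuple_pmf 0 T); apply: ler_sum => w _.
  by rewrite -!mulrDr -[leRHS]mulr1 ler_wpM2l// ltW.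
have fp1 w : 0 <= phip w <= 1.
  by have := f0 w; have := fp w; have := fm w; have := f1 w; lra.
have fm1 w : 0 <= phim w <= 1.
  by have := f0 w; have := fp w; have := fm w; have := f1 w; lra.
have := key _ _ fp1 erefl hp; have := key _ _ fm1 (sqrrN _) hm; lra.
Qed.

Lemma sqr_half_min_sqrt_le (R : realType) (l : R) (T : nat) : 0 <= l ->
  (Num.min (Num.sqrt (l / T%:R)) 1 / 2) ^+ 2 * T%:R <= l / 4.
Proof.
move=> l0; case: (posnP T) => [->|T0]; first by rewrite mulr0 divr_ge0.
have T0' : 0 < T%:R :> R by rewrite ltr0n.
have : Num.min (Num.sqrt (l / T%:R)) 1 ^+ 2 <= l / T%:R.
  apply: (@le_trans _ _ (Num.sqrt (l / T%:R) ^+ 2)); last first.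
    by rewrite sqr_sqrtr ?divr_ge0.
  by rewrite lerXn2r ?nnegrE ?le_min ?sqrtr_ge0 ?ler01 ?ge_min ?lexx.
by rewrite ler_pdivlMr//; lra.
Qed.

(** From [1 + x <= expR x], the power is at most the fourth root [y] of [1 / delta], and [delta] to
    the power 3/4 is at most [3 / 5] for [delta < 1 / 2]. *)
Lemma chi2_budget (R : realType) (delta eta : R) (T : nat) :
  0 < delta < 1 / 2 -> eta ^+ 2 * T%:R <= ln (1 / delta) / 4 ->
  delta * (1 + eta ^+ 2) ^+ T <= 3 / 5.
Proof.
move=> /andP[d0 d2] etaT.
set y := expR (ln (1 / delta) / 4).
have y4 : y ^+ 4 = 1 / delta.
  rewrite -expRM_natl -[in RHS](@lnK _ (1 / delta)) ?posrE ?divr_gt0//.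
  by congr expR; field.
have My : (1 + eta ^+ 2) ^+ T <= y.
  apply: le_trans (_ : expR (eta ^+ 2) ^+ T <= _).
    by rewrite lerXn2r ?nnegrE ?expR_ge0 ?expR_ge1Dx// addr_ge0 ?sqr_ge0.
  by rewrite -expRM_natl ler_expR mulrC.
apply: (le_trans (ler_wpM2l (ltW d0) My)).
have dy0 : 0 <= delta * y by rewrite mulr_ge0 ?expR_ge0// ltW.
(* Fourth powers remove the root; what remains is [1 / 8 <= (3 / 5) ^+ 4 = 81 / 625]. *)
rewrite -(@ler_pXn2r _ 4)// ?nnegrE ?divr_ge0//.
rewrite exprMn y4.
have -> : delta ^+ 4 * (1 / delta) = delta ^+ 3 by field; lra.
apply: (@le_trans _ _ ((1 / 2) ^+ 3)); last lra.
by rewrite lerXn2r ?nnegrE; lra.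
Qed.

Theorem mainTheorem6 (R : realType) :
  exists c : R, 0 < c /\
    forall (L rho delta : R) (T : nat),
      0 < L -> 0 < rho -> 0 < delta -> delta < 1 / 2 -> (0 < T)%N ->
      ((c * L * rho * Num.min (Num.sqrt (ln (1 / delta) / T%:R)) 1)%:E
        <= minimax_err T delta (lip_class L rho))%E.
Proof.
(* The gap contributes [1 / 8], and the halving in [eta] the remaining [1 / 2]. *)
exists (1 / 16); split; first lra.
move=> L rho delta T L0 rho0 d0 d2 T0.
have l0 : 0 < ln (1 / delta) by rewrite ln_gt0// ltr_pdivlMr//; lra.
set eta := Num.min (Num.sqrt (ln (1 / delta) / T%:R)) 1 / 2.
have -> : 1 / 16 * L * rho * Num.min (Num.sqrt (ln (1 / delta) / T%:R)) 1 =
  L * rho * eta / 8 by rewrite /eta; field.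
have eta0 : 0 <= eta by rewrite divr_ge0// le_min sqrtr_ge0 ler01.
have eta1 : eta <= 1.
  have : Num.min (Num.sqrt (ln (1 / delta) / T%:R)) 1 <= 1.
    by rewrite ge_min lexx orbT.
  by rewrite /eta; lra.
have eta01 : 0 <= eta <= 1 by rewrite eta0.
have dM : delta * (1 + eta ^+ 2) ^+ T <= 3 / 5.
  by apply: chi2_budget; [rewrite d0|exact/sqr_half_min_sqrt_le/ltW].
apply: le_ereal_inf_tmp => _ [alg _ <-]; rewrite leNgt; apply/negP => small.
have errlt I : lip_class L rho I ->
    (err alg T delta I < (L * rho * eta / 8)%:E)%E.
  move=> CI; apply: le_lt_trans small; apply: ereal_sup_ubound.
  by exists I.
pose U := uniform_prob (@ltr01 R).
pose I0 := tilted_instance L rho eta.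
(* The loss and the sample space do not depend on [theta], so this is the output on all three
   instances; only the law of [w] changes. *)
pose out (w : T.-tuple bool * measurableTypeR R) : R :=
  alg T (@sampled R (I0 0) T w).
have mout : measurable_fun setT out.
  apply: (measurableT_comp (measurable_funP (alg T))).
  exact: (@measurable_sampled R (I0 0)).
have mD (D : set R) : measurable D -> measurable (out @^-1` D).
  by move=> mD; rewrite -[X in measurable X]setTI; exact: mout.
pose phi (D : set R) (w : T.-tuple bool) : R :=
  fine (U (xsection (out @^-1` D) w)).
have phi_ge0 D w : 0 <= phi D w by rewrite fine_ge0.
have mass theta x0 (D : set R) : -1 <= theta <= 1 -> measurable D ->
    minimizers (I0 theta) x0 -> `|x0| <= rho ->
    (forall x, ~ D x ->
      L * rho * eta / 8 <= risk (I0 theta) x - risk (I0 theta) x0) ->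
    1 - delta <= \sum_w bern_tuple_pmf theta w * phi D w.
  move=> th mD' minx0 x0r gap.
  have := small_err_prob (measurable_tilted_risk L rho eta th) minx0
    (errlt _ (tilted_lip_class (ltW L0) eta01 minx0 x0r)).
  rewrite -lee_fin -(@iid_bernoulliE _ _ _ _ U)//; last exact: mD.
  move=> /le_trans; apply; apply: le_measure; rewrite ?inE.
  - have := @measurable_excess_risk R alg T (I0 theta) (risk (I0 theta) x0)
      `]-oo, L * rho * eta / 8[ (measurable_tilted_risk L rho eta th).
    by under eq_set do rewrite in_itv/=.
  - exact: mD.
  - move=> w /=; rewrite ltNge => /negP h; apply: contrapT => nD.
    exact/h/gap.
have mmid : measurable [set x : R | `|x| < rho / 2].
  rewrite (_ : mkset _ = Num.norm @^-1` `]-oo, rho / 2[); last first.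
    by apply/seteqP; split=> x /=; rewrite in_itv.
  by rewrite -[X in measurable X]setTI; apply: normr_measurable.
have mside (s : bool) : measurable [set x : R | rho / 2 < (-1) ^+ s * x].
  rewrite (_ : mkset _ = *%R ((-1) ^+ s) @^-1` `]rho / 2, +oo[); last first.
    by apply/seteqP; split=> x /=; rewrite in_itv/= andbT.
  by rewrite -[X in measurable X]setTI; apply: measurable_funM.
have mid : 1 - delta <=
    \sum_w bern_tuple_pmf 0 w * phi [set x | `|x| < rho / 2] w.
  apply: (mass 0 0); rewrite ?normr0.
  - lra.
  - exact: mmid.
  - exact: minimizers_tilted0 (ltW L0) (ltW rho0) eta0.
  - exact: ltW.
  - move=> x /= /negP; rewrite -leNgt => hx.
    exact: tilted0_gap (ltW L0) (ltW rho0) eta0 hx.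
have side (s : bool) : 1 - delta <= \sum_w bern_tuple_pmf ((-1) ^+ s * eta) w *
    phi [set x | rho / 2 < (-1) ^+ s * x] w.
  apply: (mass _ ((-1) ^+ s * rho)).
  - by case: (s); rewrite ?expr1 ?expr0; lra.
  - exact: mside.
  - exact: minimizers_tilted (ltW L0) (ltW rho0) eta01.
  - by rewrite normrMsign gtr0_norm.
  - move=> x /= /negP; rewrite -leNgt => hx.
    exact: tilted_gap (ltW L0) (ltW rho0) eta01 hx.
have right := side false; have left := side true.
have e0 : (-1) ^+ false * eta = eta by rewrite expr0 mul1r.
have e1 : (-1) ^+ true * eta = - eta by rewrite expr1 mulN1r.
rewrite e0 in right; rewrite e1 in left.
have d012 : 0 < delta < 1 / 2 by rewrite d0.
apply: (three_point_test d012 dM (phi_ge0 _) (phi_ge0 _) (phi_ge0 _)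
  _ mid right left).
(* For fixed coins the three sets of seeds are disjoint, since the corresponding sets of outputs
   are, so their probabilities sum to at most 1. *)
move=> w; rewrite -lee_fin !EFinD /phi.
set A := xsection _ w; set B := xsection _ w; set C := xsection _ w.
have mA : measurable A by exact: measurable_xsection (mD _ mmid).
have mB : measurable B by exact: measurable_xsection (mD _ (mside false)).
have mC : measurable C by exact: measurable_xsection (mD _ (mside true)).
rewrite !fineK ?fin_num_measure// -measureU//; last first.
  rewrite -subset0 => u [/xsectionP/= hA /xsectionP/=].
  rewrite expr0 mul1r; have := ler_norm (out (w, u)); lra.
have mAB : measurable (A `|` B) by exact: measurableU.
rewrite -measureU//; first by apply: probability_le1; exact: measurableU.
rewrite -subset0 => u [[/xsectionP/= hA|/xsectionP/= hB] /xsectionP/=].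
  by rewrite expr1 mulN1r; have := ler_norm (- out (w, u)); rewrite normrN; lra.
by move: hB; rewrite expr0 expr1 mul1r mulN1r; lra.
Qed.
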